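(* Let $V_1=(1,b_1,c_1,d_1)$, $V_2=(0,b_2,c_2,0)$, $V_3=(1,b_1,c_1,d_3)$ in $\mathfrak{se}(2)\times\mathbb{R}$ with $d_1\neq d_3$ and $b_2^2+c_2^2\neq 0$. Consider the map $\mathcal{IK}:\mathrm{SE}(2)\times\mathbb{R}\to\mathbb{R}^4$ whose components are $$\mathcal{IK}_1(\theta,x,y,z)=\operatorname{arctan2}(\alpha,\beta)-\mathcal{IK}_2(\theta,x,y,z),$$ $$\mathcal{IK}_2(\theta,x,y,z)=\frac{z-d_1\theta}{d_3-d_1},$$ $$\mathcal{IK}_3(\theta,x,y,z)=\rho,$$ $$\mathcal{IK}_4(\theta,x,y,z)=\theta-\operatorname{arctan2}(\alpha,\beta),$$ where $\rho=\sqrt{\alpha^2+\beta^2}$ and $$\begin{bmatrix}\alpha\\ \beta\end{bmatrix}=\frac{1}{b_2^2+c_2^2}\begin{bmatrix}b_2&c_2\\ -c_2&b_2\end{bmatrix}\left(\begin{bmatrix}x\\ y\end{bmatrix}-\begin{bmatrix}-c_1&b_1\\ b_1&c_1\end{bmatrix}\begin{bmatrix}1-\cos\theta\\ \sin\theta\end{bmatrix}\right).$$ Then $\mathcal{IK}$ is a global right inverse of the map $\mathcal{FK}^{(1,3,2,1)}:\mathbb{R}^4\to\mathrm{SE}(2)\times\mathbb{R}$, $\mathcal{FK}^{(1,3,2,1)}(t_1,t_2,t_3,t_4)=\exp(t_1V_1)\exp(t_2V_3)\exp(t_3V_2)\exp(t_4V_1)$; that is, $\mathcal{FK}^{(1,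3,2,1)}\circ\mathcal{IK}=\mathrm{id}_{\mathrm{SE}(2)\times\mathbb{R}}$.
   Context: $\mathrm{SE}(2)\times\mathbb{R}$ is the direct product of the matrix group $\mathrm{SE}(2)$ and the additive group $\mathbb{R}$, with Lie algebra $\mathfrak{se}(2)\times\mathbb{R}$. Elements of $\mathfrak{se}(2)\times\mathbb{R}$ are written $(a,b,c,d)=a e_\theta+b e_x+c e_y+d e_z$, where $e_z$ spans the $\mathbb{R}$ factor and $$e_\theta=\begin{bmatrix}0&-1&0\\ 1&0&0\\ 0&0&0\end{bmatrix},\quad e_x=\begin{bmatrix}0&0&1\\ 0&0&0\\ 0&0&0\end{bmatrix},\quad e_y=\begin{bmatrix}0&0&0\\ 0&0&1\\ 0&0&0\end{bmatrix}$$ span $\mathfrak{se}(2)$. Elements of $\mathrm{SE}(2)\times\mathbb{R}$ are written $(\theta,x,y,z)$, with $z\in\mathbb{R}$ and $(\theta,x,y)\equiv\begin{bmatrix}\cos\theta&-\sin\theta&x\\ \sin\theta&\cos\theta&y\\ 0&0&1\end{bmatrix}$. The angle $\theta$ is determined by the group element only modulo $2\pi$; in the formula for $\mathcal{IK}$, $\theta$ is a fixed choice of real representative (for instance in $(-\pi,\pi]$). $\exp$ is the exponential map, given component-wise by the matrix exponential on $\mathfrak{se}(2)$ and the identity $d\mapsto d$ on $\mathbb{R}$. $\operatorname{arctan2}(x,y)$ denotes the arctangent of $y/x$ taking into account the quadrant of the point $(x,y)$ (i.e. the polar angle of $(x,y)$, in $(-\pi,\pi]$), with the convention $\operatorname{arctan2}(0,0)=0$;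 note the order of arguments. *)

(* Defs.v *)
From HB Require Import structures.
From mathcomp Require Import all_boot all_order all_algebra.
From mathcomp Require Import all_classical all_reals all_analysis.
From mathcomp Require Import ring.

Set Implicit Arguments.
Unset Strict Implicit.
Unset Printing Implicit Defensive.

Import Order.TTheory GRing.Theory Num.Theory.
Import numFieldNormedType.Exports.

Local Open Scope classical_set_scope.
Local Open Scope ring_scope.

Definition mx_of_rows {R : realType} m n (rows : seq (seq R)) : 'M[R]_(m, n) :=
  \matrix_(i < m, j < n) (nth [::] rows i)`_j.

(* Polar angle of the point (x, y) in ]-pi, pi]: the abscissa comes first. *)
Definition arctan2 {R : realType} (x y : R) : R :=
  if 0 < x then atan (y / x)
  else if x < 0 then (if 0 <= y then atan (y / x) + pi else atan (y / x) - pi)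
  else if 0 < y then pi / 2
  else if y < 0 then - (pi / 2)
  else 0.

Definition expmx {R : realType} n (A : 'M[R]_n) : 'M[R]_n :=
  limn (series (fun k => (k`!%:R)^-1 *: A ^+ k)).

Definition se2mx {R : realType} (theta x y : R) : 'M[R]_3 :=
  mx_of_rows 3 3 [:: [:: cos theta; - sin theta; x];
                     [:: sin theta; cos theta; y];
                     [:: 0; 0; 1]].

Definition is_SE2 {R : realType} (M : 'M[R]_3) : bool :=
  `[< exists theta x y, M = se2mx theta x y >].

Record SE2 (R : realType) := MkSE2 { SE2val :> 'M[R]_3; _ : is_SE2 SE2val }.

HB.instance Definition _ (R : realType) := [isSub for @SE2val R].
HB.instance Definition _ (R : realType) := [Choice of SE2 R by <:].

Section SE2Group.
Variable R : realType.
Implicit Types g h : SE2 R.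

Lemma se2mxM (t x y t' x' y' : R) :
  se2mx t x y *m se2mx t' x' y' =
  se2mx (t + t') (x + cos t * x' - sin t * y') (y + sin t * x' + cos t * y').
Proof.
apply/matrixP => i j; rewrite !mxE !big_ord_recl big_ord0 !mxE /= cosD sinD.
case: i => [[|[|[|//]]] ?]; case: j => [[|[|[|//]]] ?] /=; ring.
Qed.

Lemma se2mx0 : se2mx 0 0 0 = 1%:M :> 'M[R]_3.
Proof.
apply/matrixP => i j; rewrite !mxE cos0 sin0.
by case: i => [[|[|[|//]]] ?]; case: j => [[|[|[|//]]] ?] //=; rewrite ?oppr0.
Qed.

Lemma is_SE2_1 : is_SE2 (1%:M : 'M[R]_3).
Proof. by apply/asboolP; exists 0, 0, 0; rewrite se2mx0. Qed.

Lemma SE2P g : exists theta x y, val g = se2mx theta x y.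
Proof. by case: g => M /= /asboolP. Qed.

Lemma is_SE2_mul g h : is_SE2 (val g *m val h).
Proof.
have [t [x [y ->]]] := SE2P g; have [t' [x' [y' ->]]] := SE2P h.
by apply/asboolP; rewrite se2mxM; do 3!eexists.
Qed.

Lemma se2mxV (t x y : R) :
  let M := se2mx (- t) (- (cos t * x + sin t * y)) (sin t * x - cos t * y) in
  se2mx t x y *m M = 1%:M /\ M *m se2mx t x y = 1%:M.
Proof.
split; rewrite se2mxM ?subrr ?addNr -se2mx0 ?cosN ?sinN; congr se2mx; last 2 first.
- by ring.
- by ring.
- transitivity (x - x * (cos t ^+ 2 + sin t ^+ 2)); first by ring.
  by rewrite cos2Dsin2; ring.
- transitivity (y - y * (cos t ^+ 2 + sin t ^+ 2)); first by ring.
  by rewrite cos2Dsin2; ring.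
Qed.

Lemma SE2_unit g : val g \in unitmx.
Proof.
have [t [x [y ->]]] := SE2P g.
by have [/mulmx1_unit[]] := se2mxV t x y.
Qed.

Lemma is_SE2_inv g : is_SE2 (invmx (val g)).
Proof.
have := SE2_unit g; have [t [x [y ->]]] := SE2P g => gu.
have [/(congr1 (mulmx (invmx (se2mx t x y))))] := se2mxV t x y.
rewrite mulKmx// mulmx1 => <- _.
by apply/asboolP; do 3!eexists.
Qed.

Definition SE2_one : SE2 R := MkSE2 is_SE2_1.
Definition SE2_mul g h : SE2 R := MkSE2 (is_SE2_mul g h).
Definition SE2_inv g : SE2 R := MkSE2 (is_SE2_inv g).

Lemma SE2_mulA : associative SE2_mul.
Proof. by move=> f g h; apply/val_inj; rewrite /= mulmxA. Qed.
Lemma SE2_mul1 : left_id SE2_one SE2_mul.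
Proof. by move=> g; apply/val_inj; rewrite /= mul1mx. Qed.
Lemma SE2_mulr1 : right_id SE2_one SE2_mul.
Proof. by move=> g; apply/val_inj; rewrite /= mulmx1. Qed.
Lemma SE2_mulV : left_inverse SE2_one SE2_inv SE2_mul.
Proof. by move=> g; apply/val_inj; rewrite /= mulVmx// SE2_unit. Qed.
Lemma SE2_mulrV : right_inverse SE2_one SE2_inv SE2_mul.
Proof. by move=> g; apply/val_inj; rewrite /= mulmxV// SE2_unit. Qed.

HB.instance Definition _ :=
  isGroup.Build (SE2 R) SE2_mulA SE2_mul1 SE2_mulr1 SE2_mulV SE2_mulrV.

End SE2Group.

(* SE(2) x R, with the additive group law on the second factor. *)

Definition SE2R (R : realType) : Type := (SE2 R * R)%type.
HB.instance Definition _ (R : realType) := Choice.on (SE2R R).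

Section SE2RGroup.
Variable R : realType.
Implicit Types g h : SE2R R.

Definition SE2R_one : SE2R R := (1%g, 0).
Definition SE2R_mul g h : SE2R R := ((g.1 * h.1)%g, g.2 + h.2).
Definition SE2R_inv g : SE2R R := ((g.1^-1)%g, - g.2).

Lemma SE2R_mulA : associative SE2R_mul.
Proof. by move=> f g h; rewrite /SE2R_mul mulgA addrA. Qed.
Lemma SE2R_mul1 : left_id SE2R_one SE2R_mul.
Proof. by move=> [g z]; rewrite /SE2R_mul /= mul1g add0r. Qed.
Lemma SE2R_mulr1 : right_id SE2R_one SE2R_mul.
Proof. by move=> [g z]; rewrite /SE2R_mul /= mulg1 addr0. Qed.
Lemma SE2R_mulV : left_inverse SE2R_one SE2R_inv SE2R_mul.
Proof. by move=> g; rewrite /SE2R_mul /= mulVg addNr. Qed.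
Lemma SE2R_mulrV : right_inverse SE2R_one SE2R_inv SE2R_mul.
Proof. by move=> g; rewrite /SE2R_mul /= mulgV subrr. Qed.

HB.instance Definition _ :=
  isGroup.Build (SE2R R) SE2R_mulA SE2R_mul1 SE2R_mulr1 SE2R_mulV SE2R_mulrV.

End SE2RGroup.

Section LieAlgebra.
Variable R : realType.

Definition mx_theta : 'M[R]_3 :=
  mx_of_rows 3 3 [:: [:: 0; -1; 0]; [:: 1; 0; 0]; [:: 0; 0; 0]].
Definition mx_x : 'M[R]_3 :=
  mx_of_rows 3 3 [:: [:: 0; 0; 1]; [:: 0; 0; 0]; [:: 0; 0; 0]].
Definition mx_y : 'M[R]_3 :=
  mx_of_rows 3 3 [:: [:: 0; 0; 0]; [:: 0; 0; 1]; [:: 0; 0; 0]].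

Definition se2 : {vspace 'M[R]_3} := <<[:: mx_theta; mx_x; mx_y]>>%VS.

Definition se2R : lmodType R := (subvs_of se2 * R^o)%type.

(* vsproj only coerces these matrices, which lie in se2, to the subtype. *)
Definition e_theta : se2R := (vsproj se2 mx_theta, 0).
Definition e_x : se2R := (vsproj se2 mx_x, 0).
Definition e_y : se2R := (vsproj se2 mx_y, 0).
Definition e_z : se2R := (0, 1).

Definition se2R_elt (a b c d : R) : se2R :=
  a *: e_theta + b *: e_x + c *: e_y + d *: e_z.

Lemma se2_span (a b c : R) : a *: mx_theta + b *: mx_x + c *: mx_y \in se2.
Proof. by rewrite !memvD// memvZ// memv_span// !inE eqxx ?orbT. Qed.

Lemma se2P (X : 'M[R]_3) : X \in se2 ->
  exists a b c, X = a *: mx_theta + b *: mx_x + c *: mx_y.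
Proof.
rewrite /se2 span_cons span_cons span_seq1.
move=> /memv_addP[_ /vlineP[a ->]] [_ /memv_addP[_ /vlineP[b ->]] [_ /vlineP[c ->]] ->] ->.
by exists a, b, c; rewrite addrA.
Qed.

End LieAlgebra.

Section Exponential.
Variable R : realType.

Lemma lim_series_eventually0 (V : normedModType R) (u : V ^nat) N :
  (forall n, (N <= n)%N -> u n = 0) -> series u @ \oo --> series u N.
Proof.
move=> u0; apply: cvg_near_cst; near=> n.
have Nn : (N <= n)%N by near: n; exact: nbhs_infty_ge.
apply/eqP; rewrite -subr_eq0 sub_series_geq// big_nat big1// => i /andP[Ni _].
exact: u0.
Unshelve. all: by end_near. Qed.

Lemma expmx_se2_0 (b c : R) :
  expmx (0 *: mx_theta R + b *: mx_x R + c *: mx_y R) = se2mx 0 b c.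
Proof.
set A := (X in expmx X).
have A2 : A *m A = 0.
  apply/matrixP => i j; rewrite !mxE !big_ord_recl big_ord0 !mxE /=.
  case: i => [[|[|[|//]]] ?]; case: j => [[|[|[|//]]] ?] /=; ring.
apply: cvg_lim; first exact: norm_hausdorff.
have -> : se2mx 0 b c = series (fun k => (k`!%:R)^-1 *: A ^+ k) 2.
  rewrite /series /= !big_nat_recr//= big_nil expr0 expr1 !invr1 !scale1r add0r.
  apply/matrixP => i j; rewrite !mxE cos0 sin0.
  case: i => [[|[|[|//]]] ?]; case: j => [[|[|[|//]]] ?] /=; ring.
apply: lim_series_eventually0 => -[|[|n]]// _.
by rewrite !exprS mulrA [A * A]A2 mul0r scaler0.
Qed.

Lemma expmx_se2 (a b c : R) : a != 0 ->
  expmx (a *: mx_theta R + b *: mx_x R + c *: mx_y R) =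
  se2mx a (a^-1 * (b * sin a - c * (1 - cos a)))
          (a^-1 * (b * (1 - cos a) + c * sin a)).
Proof.
move=> a0; set A := (X in expmx X).
pose u := a^-1 * c; pose v := - (a^-1 * b).
pose P : 'M[R]_3 := mx_of_rows 3 3 [:: [:: 1; 0; u]; [:: 0; 1; v]; [:: 0; 0; 0]].
pose Q : 'M[R]_3 := mx_of_rows 3 3 [:: [:: 0; -1; - v]; [:: 1; 0; u]; [:: 0; 0; 0]].
have AP : A * P = a *: Q.
  apply/matrixP => i j; rewrite !mxE !big_ord_recl big_ord0 !mxE /= /u /v.
  by case: i => [[|[|[|//]]] ?]; case: j => [[|[|[|//]]] ?] /=; field.
have AQ : A * Q = - a *: P.
  apply/matrixP => i j; rewrite !mxE !big_ord_recl big_ord0 !mxE /= /u /v.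
  by case: i => [[|[|[|//]]] ?]; case: j => [[|[|[|//]]] ?] /=; field.
have A1P : A * (1 - P) = 0.
  rewrite mulrBr mulr1 AP; apply/matrixP => i j; rewrite !mxE /= /u /v.
  by case: i => [[|[|[|//]]] ?]; case: j => [[|[|[|//]]] ?] /=; field.
pose C k : R := (~~ odd k)%:R * (-1) ^+ k./2.
pose S k : R := (odd k)%:R * (-1) ^+ k.-1./2.
have CS k : C k.+1 = - S k.
  rewrite /C /S /= negbK; case: k => [|k]; rewrite /= ?mul0r ?oppr0//.
  by case: (odd k); rewrite /= ?mul0r ?oppr0// !mul1r exprS mulN1r.
have SC k : S k.+1 = C k by [].
have Apow k : A ^+ k = (a ^+ k * C k) *: P + (a ^+ k * S k) *: Q
                       + (k == 0)%N%:R *: (1 - P).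
  elim: k => [|k IH].
    by rewrite /C /S /= !expr0 !mul1r mul0r !scale1r scale0r addr0 addrC subrK.
  rewrite exprS IH !mulrDr -!(scalerAr _ A) AP AQ A1P scaler0 scale0r !addr0.
  rewrite CS SC !scalerA addrC exprS; congr (_ *: _ + _ *: _); ring.
pose T k : 'M[R]_3 := (k == 0)%N%:R *: (1 - P).
apply: cvg_lim; first exact: norm_hausdorff.
have -> : (fun k => (k`!%:R)^-1 *: A ^+ k) =
    (fun k => cos_coeff a k *: P + sin_coeff a k *: Q + T k).
  apply/funext => k; rewrite Apow !scalerDr !scalerA; congr (_ *: _ + _ *: _ + _).
  - by rewrite /cos_coeff /= /C mulrC [a ^+ k * _]mulrC.
  - by rewrite /sin_coeff /= /S mulrC [a ^+ k * _]mulrC.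
  - by rewrite -scalerDr /T; case: k => [|k]; rewrite ?mulr0// fact0 invr1 mul1r.
have -> : series (fun k => cos_coeff a k *: P + sin_coeff a k *: Q + T k) =
    (fun n => series (cos_coeff a) n *: P + series (sin_coeff a) n *: Q
              + series T n).
  by apply/funext => n; rewrite /series /= !big_split/= !scaler_suml.
have -> : se2mx a (a^-1 * (b * sin a - c * (1 - cos a)))
    (a^-1 * (b * (1 - cos a) + c * sin a)) = cos a *: P + sin a *: Q + series T 1.
  rewrite /series /= big_nat1 /T scale1r.
  apply/matrixP => i j; rewrite !mxE /= /u /v.
  by case: i => [[|[|[|//]]] ?]; case: j => [[|[|[|//]]] ?] /=; field.
apply: cvgD; first apply: cvgD.
- by apply: cvgZr_tmp; rewrite cos.unlock; exact: is_cvg_series_cos_coeff.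
- by apply: cvgZr_tmp; rewrite sin.unlock; exact: is_cvg_series_sin_coeff.
- apply: lim_series_eventually0 => -[//|n] _; exact: scale0r.
Qed.

Lemma is_SE2_exp (X : subvs_of (se2 R)) : is_SE2 (expmx (vsval X)).
Proof.
have [a [b [c ->]]] := se2P (subvsP X).
apply/asboolP; have [->|a0] := eqVneq a 0.
  by rewrite expmx_se2_0; do 3!eexists.
by rewrite expmx_se2//; do 3!eexists.
Qed.

Definition exp (V : se2R R) : SE2R R := (MkSE2 (is_SE2_exp V.1), V.2).

End Exponential.

Section Kinematics.
Variable R : realType.

Definition FK1321 (V1 V2 V3 : se2R R) (t : 'rV[R]_4) : SE2R R :=
  let t1 := t 0 0 in
  let t2 := t 0 1 in
  let t3 := t 0 2 in
  let t4 := t 0 3 in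
  (exp (t1 *: V1) * exp (t2 *: V3) * exp (t3 *: V2) * exp (t4 *: V1))%g.

(* The angle of a group element is only determined modulo 2 * pi: [angle] is
   any choice of a real representative for every element. *)
Definition is_angle_choice (angle : SE2R R -> R) : Prop :=
  forall g : SE2R R, exists x y, val g.1 = se2mx (angle g) x y.

Lemma angle_choice_exists : exists angle, is_angle_choice angle.
Proof.
have /choice[angle angleP] : forall g : SE2R R,
    exists theta, exists x y, val g.1 = se2mx theta x y.
  by move=> g; exact: SE2P.
by exists angle.
Qed.

Definition IK (angle : SE2R R -> R) (b1 c1 d1 b2 c2 d3 : R) (g : SE2R R) :
    'rV[R]_4 :=
  let theta := angle g in
  let x := val g.1 0 2 in
  let y := val g.1 1 2 in
  let z := g.2 in
  let ab : 'cV[R]_2 :=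
    (b2 ^+ 2 + c2 ^+ 2)^-1 *: (mx_of_rows 2 2 [:: [:: b2; c2]; [:: - c2; b2]]
      *m (mx_of_rows 2 1 [:: [:: x]; [:: y]]
          - mx_of_rows 2 2 [:: [:: - c1; b1]; [:: b1; c1]]
            *m mx_of_rows 2 1 [:: [:: 1 - cos theta]; [:: sin theta]])) in
  let alpha := ab 0 0 in
  let beta := ab 1 0 in
  let rho := Num.sqrt (alpha ^+ 2 + beta ^+ 2) in
  let ik2 := (z - d1 * theta) / (d3 - d1) in
  let ik1 := arctan2 alpha beta - ik2 in
  let ik3 := rho in
  let ik4 := theta - arctan2 alpha beta in
  mx_of_rows 1 4 [:: [:: ik1; ik2; ik3; ik4]].

End Kinematics.

(* Main.v *)
Require Import Defs.
From mathcomp Require Import all_boot all_order all_algebra.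
From mathcomp Require Import all_classical all_reals all_analysis.
From mathcomp Require Import ring.

Import Order.TTheory GRing.Theory Num.Theory.
Local Open Scope ring_scope.

(** V1 and V3 have the same SE(2) part, so t |-> exp(tV1) and t |-> exp(tV3)
    project to one and the same one-parameter subgroup of SE(2), with angle t
    and translation p(t) = (screw_x t, screw_y t). Hence the product of the four
    exponentials has angle t1 + t2 + t4 and translation
    p(t1 + t2 + t4) + t3 Rot(t1 + t2) (b2, c2).
    Along IK, t1 + t2 is the polar angle of (alpha, beta) and t3 its modulus,
    so t3 Rot(t1 + t2) (b2, c2) is the complex product
    (alpha + i beta) (b2 + i c2), i.e. (x, y) - p(theta) by the choice of alpha
    and beta; and t2 is tuned so that the last coordinate equals z. *)

Section Polar.
Variable R : realType.
Implicit Types x y : R.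

(** Factor [x ^+ 2] out of the root: [cos (atan u)] is the inverse of the root of [1 + u ^+ 2]. *)
Lemma sqrt_sqrD_atan x y : x != 0 ->
  Num.sqrt (x ^+ 2 + y ^+ 2) = `|x| / cos (atan (y / x)).
Proof.
move=> x0; rewrite cos_atan invrK -sqrtr_sqr -sqrtrM ?sqr_ge0//.
by congr Num.sqrt; field.
Qed.

Lemma cos_atan_neq0 x : cos (atan x) != 0.
Proof. by rewrite gt_eqF// cos_gt0_pihalf// atan_gtNpi2 atan_ltpi2. Qed.

Lemma sin_atanE x : sin (atan x) = x * cos (atan x).
Proof. by rewrite -{2}(atanK x) /tan divfK// cos_atan_neq0. Qed.

(** For [x != 0], [atan (y / x)] gives the direction up to sign, and a shift by pi either way flips
    cosine and sine when [x < 0]. For [x = 0] the modulus is the absolute value of [y]. *)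
Lemma arctan2_polar x y : let rho := Num.sqrt (x ^+ 2 + y ^+ 2) in
  rho * cos (arctan2 x y) = x /\ rho * sin (arctan2 x y) = y.
Proof.
rewrite /= /arctan2; case: ltrgt0P => x0.
- rewrite sqrt_sqrD_atan ?gt_eqF// gtr0_norm// sin_atanE.
  have x1 : x != 0 by rewrite gt_eqF.
  have := cos_atan_neq0 (y / x); set c := cos _ => c0.
  by split; field; rewrite ?c0 ?x1.
- rewrite sqrt_sqrD_atan ?lt_eqF// ltr0_norm//.
  have x1 : x != 0 by rewrite lt_eqF.
  have := cos_atan_neq0 (y / x).
  by case: ifP => _; rewrite ?cosDpi ?sinDpi ?cosD ?sinD ?cosN ?sinN ?cospi ?sinpi sin_atanE;
  set c := cos _ => c0; split; field; rewrite ?c0 ?x1.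
- rewrite x0 expr0n add0r sqrtr_sqr; case: ltrgt0P => y0.
  + by rewrite cos_pihalf sin_pihalf mulr0 mulr1.
  + by rewrite cosN sinN cos_pihalf sin_pihalf mulr0 mulrN1 opprK.
  + by rewrite y0 !mul0r.
Qed.

End Polar.

Section ExpSE2R.
Variable R : realType.
Implicit Types a b c d t : R.

Lemma se2R_elt1E a b c d : vsval (se2R_elt a b c d).1 =
  a *: mx_theta R + b *: mx_x R + c *: mx_y R.
Proof.
have -> : (se2R_elt a b c d).1 = a *: vsproj (se2 R) (mx_theta R)
    + b *: vsproj (se2 R) (mx_x R) + c *: vsproj (se2 R) (mx_y R).
  by rewrite /se2R_elt /= scaler0 addr0.
by rewrite !linearD/= !vsprojK// memv_span// !inE eqxx ?orbT.
Qed.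

Lemma se2R_elt2E a b c d : (se2R_elt a b c d).2 = d.
Proof. by rewrite /se2R_elt /= !scaler0 !add0r [_ *: _]mulr1. Qed.

Lemma val_expZ t (V : se2R R) :
  val (exp (t *: V)).1 = expmx (t *: vsval V.1).
Proof. by []. Qed.

Definition screw_x b c t := b * sin t - c * (1 - cos t).
Definition screw_y b c t := b * (1 - cos t) + c * sin t.

Lemma val_exp_screw b c d t : val (exp (t *: se2R_elt 1 b c d)).1 =
  se2mx t (screw_x b c t) (screw_y b c t).
Proof.
rewrite val_expZ se2R_elt1E 2!scalerDr !scalerA mulr1 /screw_x /screw_y.
(* [expmx_se2] divides by the angle, so angle 0 goes through [expmx_se2_0]. *)
have [->|t0] := eqVneq t 0.
  by rewrite !mul0r expmx_se2_0 cos0 sin0 subrr !mulr0 subr0 addr0.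
by rewrite expmx_se2//; congr se2mx; field.
Qed.

Lemma val_exp_trans b c t : val (exp (t *: se2R_elt 0 b c 0)).1 =
  se2mx 0 (t * b) (t * c).
Proof.
by rewrite val_expZ se2R_elt1E 2!scalerDr !scalerA mulr0 expmx_se2_0.
Qed.

Lemma exp2E a b c d t : (exp (t *: se2R_elt a b c d)).2 = t * d.
Proof. by rewrite -[in RHS](se2R_elt2E a b c d). Qed.

Lemma SE2R_ext (g h : SE2R R) : val g.1 = val h.1 -> g.2 = h.2 -> g = h.
Proof. by case: g h => [? ?] [? ?] /= /val_inj -> ->. Qed.

Lemma val_SE2R_mul1 (g h : SE2R R) : val (g * h)%g.1 = val g.1 *m val h.1.
Proof. by []. Qed.

Lemma SE2R_mul2 (g h : SE2R R) : (g * h)%g.2 = g.2 + h.2.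
Proof. by []. Qed.

(** The addition formulas give p(s + t) = p(s) + Rot(s) p(t), so the three screw translations merge
    into one. *)
Lemma val_FK1321 b1 c1 d1 b2 c2 d3 (t : 'rV[R]_4) :
  let phi := t 0 0 + t 0 1 in
  val (FK1321 (se2R_elt 1 b1 c1 d1) (se2R_elt 0 b2 c2 0)
              (se2R_elt 1 b1 c1 d3) t).1 =
  se2mx (phi + t 0 3)
    (screw_x b1 c1 (phi + t 0 3) + t 0 2 * (b2 * cos phi - c2 * sin phi))
    (screw_y b1 c1 (phi + t 0 3) + t 0 2 * (b2 * sin phi + c2 * cos phi)).
Proof.
move=> phi; rewrite /FK1321; cbv zeta; rewrite !val_SE2R_mul1.
rewrite (val_exp_screw _ _ d1 (t 0 0)) (val_exp_screw _ _ d3 (t 0 1)).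
rewrite (val_exp_screw _ _ d1 (t 0 3)) (val_exp_trans b2 c2 (t 0 2)).
rewrite !se2mxM addr0 -/phi.
by rewrite /screw_x /screw_y; congr se2mx; rewrite !(cosD, sinD); ring.
Qed.

Lemma FK1321_2E b1 c1 d1 b2 c2 d3 (t : 'rV[R]_4) :
  (FK1321 (se2R_elt 1 b1 c1 d1) (se2R_elt 0 b2 c2 0)
          (se2R_elt 1 b1 c1 d3) t).2 =
  t 0 0 * d1 + t 0 1 * d3 + t 0 3 * d1.
Proof.
by rewrite /FK1321; cbv zeta; rewrite !SE2R_mul2 !exp2E mulr0 addr0.
Qed.

End ExpSE2R.

Arguments screw_x {R} b c t.
Arguments screw_y {R} b c t.

Theorem mainTheorem4 (R : realType) (b1 c1 d1 b2 c2 d3 : R)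
    (angle : SE2R R -> R) :
  d1 != d3 -> b2 ^+ 2 + c2 ^+ 2 != 0 -> is_angle_choice angle ->
  let V1 := se2R_elt 1 b1 c1 d1 in
  let V2 := se2R_elt 0 b2 c2 0 in
  let V3 := se2R_elt 1 b1 c1 d3 in
  FK1321 V1 V2 V3 \o IK angle b1 c1 d1 b2 c2 d3 =1 id.
Proof.
move=> d13 n0 angleP V1 V2 V3 g; rewrite [LHS]/=.
have d31 : d3 - d1 != 0 by rewrite subr_eq0 eq_sym.
have [x [y gE]] := angleP g.
set th := angle g in gE.
(* The matrix-vector product subtracted in [IK] is p(th). *)
pose X := x - screw_x b1 c1 th; pose Y := y - screw_y b1 c1 th.
pose n := b2 ^+ 2 + c2 ^+ 2.
pose al := (b2 * X + c2 * Y) / n; pose be := (b2 * Y - c2 * X) / n.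
set t := IK _ _ _ _ _ _ _ g.
have [t1 t2 t3 t4] : [/\ t 0 0 = arctan2 al be - (g.2 - d1 * th) / (d3 - d1),
    t 0 1 = (g.2 - d1 * th) / (d3 - d1), t 0 2 = Num.sqrt (al ^+ 2 + be ^+ 2)
    & t 0 3 = th - arctan2 al be].
  rewrite /t /IK gE !mxE /= !(mxE, big_ord_recl, big_ord0) /= -/th -/n.
  set al' := n^-1 * _; set be' := n^-1 * (- c2 * _ + _).
  have -> : al' = al by rewrite /al' /al /X /Y /screw_x /screw_y; ring.
  by have -> : be' = be by rewrite /be' /be /X /Y /screw_x /screw_y; ring.
have [rc rs] := arctan2_polar _ al be.
(* The weights of [d1] sum to [th - t 0 1], so the height is [d1 * th + (d3 - d1) * t 0 1]. *)
apply: SE2R_ext; last by rewrite FK1321_2E t1 t2 t4; field.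
(* [t 0 0 + t 0 1] collapses to the polar angle and the full sum to [th] itself, not merely modulo 2
   pi. *)
rewrite val_FK1321 t1 t2 t3 t4 gE subrK addrC subrK.
set phi := arctan2 al be in rc rs *.
(* By construction [al + i be] is [X + i Y] divided by [b2 + i c2]. *)
by congr se2mx; rewrite ?mulrDr ?mulrN !(mulrCA (Num.sqrt _)) rc rs
  /al /be /X /Y /n; field.
Qed.
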